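(* Let $G$ be a finite simple graph which is a bipartite graph, or a $(C_4,C_5)$-free vertex decomposable graph, or a whisker graph (that is, $G=W_{H}$ for some simple graph $H$). Let $R=K[V(G)]$ and let $I(G)\subset R$ be the edge ideal of $G$. Then $$\mathrm{v}(I(G))\le \mathrm{im}(G)\le \mathrm{reg}(R/I(G)).$$
   Context: $K$ is a field; $R=K[V(G)]$ is the polynomial ring whose variables are the vertices of $G$, with the standard grading. The edge ideal $I(G)$ is generated by the monomials $xy$ with $\{x,y\}\in E(G)$. For a proper graded ideal $I$ of $R$, its v-number is $\mathrm{v}(I)=\min\{d\ge 0 : \exists f\in R_d \text{ and } \mathfrak{p}\in\mathrm{Ass}(R/I)\text{ with } (I:f)=\mathfrak{p}\}$, where $R_d$ is the degree-$d$ component of $R$. $\mathrm{reg}(R/I)$ is the Castelnuovo-Mumford regularity, $\max\{j-i:\beta_{i,j}(R/I)\ne0\}$. An induced matching in $G$ is a set $M$ of pairwise disjoint edges such that the induced subgraph of $G$ on $\bigcup_{e\in M}e$ has edge set exactly $M$; $\mathrm{im}(G)$ is the maximum cardinality of an induced matching. $G$ is $(C_4,C_5)$-free if it has no induced cycle of length $4$ or $5$. $G$ is vertex decomposable if its independence complex (the simplicial complex of independent sets of $G$) is vertex decomposable, where a simplicial complex $\Delta$ is vertex decomposable if it is a simplex, or empty, or has a vertex $v$ such that (a) both $\mathrm{del}_\Delta(v)=\{F\in\Delta: v\notin F\}$ and $\mathrm{lk}_\Delta(v)=\{F\in\Delta: v\notin F,\ F\cup\{v\}\in\Delta\}$ are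 vertex decomposable, and (b) every facet of $\mathrm{del}_\Delta(v)$ is a facet of $\Delta$. For a simple graph $H$ with $V(H)=\{x_1,\ldots,x_n\}$, the whisker graph $W_H$ is obtained from $H$ by adding new vertices $y_1,\ldots,y_n$ and the edges $\{x_i,y_i\}$ for $1\le i\le n$. *)

(* Defs.v *)
From HB Require Import structures.
(* mpoly redefines symmetric; the later import restores the one on relations.   *)
From mathcomp Require Import mpoly.
From mathcomp Require Import all_boot all_order all_algebra.

Set Implicit Arguments.
Unset Strict Implicit.
Unset Printing Implicit Defensive.

Import GRing.Theory.
Local Open Scope ring_scope.

(* A simple graph on the finite vertex type T is a symmetric irreflexive       *)
(* relation on T.                                                              *)

Section Graphs.
Variable T : finType.
Implicit Types (e : rel T) (M D : {set {set T}}) (A F : {set T}).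

Definition edges e : {set {set T}} :=
  [set [set p.1; p.2] | p : T * T & e p.1 p.2].

Definition induced_matching e M : bool :=
  [&& M \subset edges e, trivIset M
    & [set E in edges e | E \subset cover M] == M].

Definition induced_matching_number e : nat :=
  \max_(M : {set {set T}} | induced_matching e M) #|M|.

Definition bipartite e : Prop :=
  exists A : {set T}, forall x y, e x y -> (x \in A) != (y \in A).

(* Only meaningful for k >= 3; ordS is the successor modulo k. *)
Definition has_induced_cycle e (k : nat) : Prop :=
  exists f : 'I_k -> T, injective f /\
    forall i j, e (f i) (f j) = (j == ordS i) || (i == ordS j).

Definition C4C5_free e : Prop :=
  ~ has_induced_cycle e 4 /\ ~ has_induced_cycle e 5.

Definition deletion D (v : T) : {set {set T}} := [set F in D | v \notin F].

Definition link D (v : T) : {set {set T}} :=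
  [set F : {set T} | (v \notin F) && (v |: F \in D)].

Definition facet D F : bool := maxset (fun F' => F' \in D) F.

(* D stands for a simplicial complex, which may be void (set0). *)
Inductive vertex_decomposable : {set {set T}} -> Prop :=
| vd_empty : vertex_decomposable set0
| vd_simplex A : vertex_decomposable (powerset A)
| vd_shed D v of [set v] \in D
    & vertex_decomposable (deletion D v)
    & vertex_decomposable (link D v)
    & (forall F, facet (deletion D v) F -> facet D F) :
    vertex_decomposable D.

Definition independence_complex e : {set {set T}} :=
  [set A : {set T} | [forall x in A, forall y in A, ~~ e x y]].

Definition vertex_decomposable_graph e : Prop :=
  vertex_decomposable (independence_complex e).

End Graphs.

(* inl x is the vertex x of H and inr x is the end of the whisker at x. *)
Definition whisker (U : finType) (h : rel U) : rel (U + U) := fun a b =>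
  match a, b with
  | inl x, inl y => h x y
  | inl x, inr y => x == y
  | inr x, inl y => x == y
  | inr _, inr _ => false
  end.

Definition whisker_graph (T : finType) (e : rel T) : Prop :=
  exists (U : finType) (h : rel U) (f : U + U -> T),
    [/\ symmetric h, irreflexive h, bijective f
      & forall a b, e (f a) (f b) = whisker h a b].

(* Ideals are arbitrary, possibly undecidable, subsets, hence Prop-valued. *)

Section Ideals.
Variable R : comNzRingType.
Implicit Types I P : R -> Prop.

Definition is_ideal I : Prop :=
  [/\ I 0, forall f g, I f -> I g -> I (f + g) & forall r f, I f -> I (r * f)].

Definition is_prime_ideal P : Prop :=
  [/\ is_ideal P, ~ P 1 & forall f g, P (f * g) -> P f \/ P g].

Definition colon I (f : R) : R -> Prop := fun g => I (g * f).

(* P is in Ass(R/I): P is prime and is the annihilator of the class of some g. *)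
Definition associated_prime I P : Prop :=
  is_prime_ideal P /\ exists g, forall r, colon I g r <-> P r.

End Ideals.

Section PolynomialRing.
Variables (K : fieldType) (n : nat).
Local Notation R := {mpoly K[n]}.
Implicit Types I : R -> Prop.

Definition v_attained I (d : nat) : Prop :=
  exists2 f : R, f \is d.-homog
    & exists2 P : R -> Prop, associated_prime I P
      & forall g, colon I f g <-> P g.

Definition is_v_number I (v : nat) : Prop :=
  v_attained I v /\ forall d, v_attained I d -> (v <= d)%N.

(* ... -> F_2 -> F_1 -> F_0 -> R, where F_i is the graded free module with    *)
(* basis indexed by 'I_(rk i), the k-th basis element having degree shift i k. *)
(* Elements of F_i are row vectors and maps act by right multiplication, so    *)
(* row k of [diff i] is the image in F_i of the k-th basis element of F_(i+1). *)
(* Shifts in nat are no restriction for resolutions of R/I: R/I lives in       *)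
(* nonnegative degrees, hence so do its minimal generators and syzygies.       *)
Record free_sequence := FreeSequence {
  rk : nat -> nat;
  shift : forall i, 'I_(rk i) -> nat;
  aug : 'M[R]_(rk 0, 1);
  diff : forall i, 'M[R]_(rk i.+1, rk i)
}.

(* Composing aug with the projection R -> R/I gives the augmentation F_0 -> R/I; *)
(* being zero in R/I is membership in I. A map of degree 0 has (k, l) entry      *)
(* homogeneous of degree shift(k) - shift(l), and zero when this is negative.    *)
(* Minimality says that F_(i+1) is mapped into (x_1, ..., x_n) F_i.              *)
Definition minimal_graded_free_resolution I (F : free_sequence) : Prop :=
  [/\ (forall k, aug F k 0 \is (shift k).-homog)
      /\ (forall i k l m, m \in msupp (diff F i k l) ->
            (mdeg m + shift l = shift k)%N),
      forall p, exists u : 'rV_(rk F 0), I (p - (u *m aug F) 0 0),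
      forall u : 'rV_(rk F 0), I ((u *m aug F) 0 0) <->
        exists w, u = w *m diff F 0,
      forall i (u : 'rV_(rk F i.+1)), u *m diff F i = 0 <->
        exists w, u = w *m diff F i.+1
    & forall i k l, (diff F i k l)@_0%MM = 0].

Definition betti (F : free_sequence) (i j : nat) : nat :=
  #|[set k : 'I_(rk F i) | shift k == j]|.

(* r = max {j - i : beta_{i,j}(R/I) <> 0}. The maximum is never negative when  *)
(* R/I <> 0, because beta_{0,0}(R/I) = 1.                                      *)
Definition is_regularity I (r : nat) : Prop :=
  exists F, [/\ minimal_graded_free_resolution I F,
    exists i j, betti F i j != 0%N /\ j = (i + r)%N
    & forall i j, betti F i j != 0%N -> (j <= i + r)%N].

End PolynomialRing.

(* The variables of K[V(G)] are indexed by the vertices through enum_rank. *)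
Definition edge_ideal (K : fieldType) (T : finType) (e : rel T) :
    {mpoly K[#|T|]} -> Prop := fun p =>
  exists c : T -> T -> {mpoly K[#|T|]},
    p = \sum_x \sum_(y | e x y) c x y * ('X_(enum_rank x) * 'X_(enum_rank y)).
Arguments edge_ideal K [T] e _.

(* Main.v *)
Require Import Defs.
From mathcomp Require Import mpoly.
From mathcomp Require Import all_boot all_order all_algebra.

From Stdlib Require Import Classical_Prop.

Set Implicit Arguments.
Unset Strict Implicit.
Unset Printing Implicit Defensive.

(** Upper bound on the v-number.  If A is an independent set whose
neighbourhood N(A) is a vertex cover, then the colon ideal of I(G) by the
product of the variables of A is generated by the variables of N(A), hence is
prime, and v(I(G)) <= #|A| ([v_attained_dominating]).  In each of the three
classes such an A exists together with partners p a, for a in A, for which the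
edges {a, p a} form an induced matching, so that #|A| <= im(G)
([rooted_matching_le]).  In a bipartite graph A is a minimal subset of one side
that dominates the non-isolated vertices of the other; in a whisker graph W_H
it is a maximal independent set of H; in a (C4,C5)-free vertex decomposable
graph it is built along the links of shedding vertices, because a shedding
vertex v has a neighbour x with N[x] contained in N[v], and the edge {v, x}
extends every induced matching of the graph induced on the complement of N[v].

Lower bound on the regularity, for every graph.  Let mu_0, ..., mu_(s-1) be the
monomials of the edges of an induced matching.  They are pairwise coprime, lie
in I(G), and together with the variables z outside the matching they generate a
monomial ideal that contains I(G), precisely because the matching is induced.
Given a graded free resolution F of R/I(G), two families are built side by side
([paired_cochain]):
 - linear forms psi_i : F_i -> R, homogeneous of degree - (2 i), that are
   cocycles modulo (mu_i, ..., mu_(s-1), z); psi_0 is the augmentation, and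
   psi_(i+1) is the quotient of psi_i o d by mu_i.  These are the iterated
   connecting homomorphisms Ext^i -> Ext^(i+1);
 - elements u_i of F_i that are cycles modulo (mu_0, ..., mu_(i-1)); u_0 lifts
   1, and u_(i+1) is the image of u_i under a null-homotopy of the
   multiplication by mu_i on F.  These are the dual connecting homomorphisms
   for Tor.
The coefficient of mu_i in psi_i (d u_(i+1)) is on the one hand the constant
term of psi_(i+1) (u_(i+1)), and on the other hand that of psi_i (u_i).  So all
psi_i (u_i) have constant term 1.  Therefore psi_s maps some basis element of
F_s to a polynomial with a nonzero constant term, and by homogeneity this basis
element has degree 2 s; hence s <= reg(R/I(G)). *)

(** * Dominating independent sets carrying an induced matching *)

Section DominatingMatchings.
Variables (T : finType) (e : rel T).
Hypotheses (e_sym : symmetric e) (e_irr : irreflexive e).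
Implicit Types (A W S F : {set T}) (p : T -> T).

(** Equivalently, the edges {a, p a} for a in A form an induced matching: the
condition on e a (p b) forces p to be injective, with image disjoint from A. *)
Definition rooted_matching A p : Prop :=
  [/\ {in A &, forall a b, ~~ e a b},
      {in A &, forall a b, e a (p b) = (a == b)}
    & {in A &, forall a b, ~~ e (p a) (p b)}].

(** The neighbourhood of A is a vertex cover of the graph induced on W. *)
Definition covering W A : Prop :=
  forall x y, x \in W -> y \in W -> e x y -> exists2 a, a \in A & e a x || e a y.

Lemma rooted_matching_le A p :
  rooted_matching A p -> #|A| <= induced_matching_number e.
Proof.
case=> indA rtA indp.
have aNp a b : a \in A -> b \in A -> a != p b.
  move=> aA bA; apply/eqP=> ab; move: (indA b a bA aA).
  by rewrite ab rtA ?eqxx.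
have pinj a b : a \in A -> b \in A -> p a = p b -> a = b.
  by move=> aA bA pab; apply/eqP; rewrite -rtA // -pab rtA.
have in_blk a x : (x \in [set a; p a]) = (x == a) || (x == p a) by rewrite !inE.
have meet a b x : a \in A -> b \in A ->
    x \in [set a; p a] -> x \in [set b; p b] -> a = b.
  move=> aA bA; rewrite !in_blk => /orP[]/eqP-> /orP[]/eqP.
  - by [].
  - by move/eqP; rewrite (negPf (aNp _ _ _ _)).
  - by move/esym/eqP; rewrite (negPf (aNp _ _ _ _)).
  - exact: pinj.
pose M := [set [set a; p a] | a in A].
have <- : #|M| = #|A|.
  apply: card_in_imset => a b aA bA ab; apply: (@meet a b a) => //.
    by rewrite !inE eqxx.
  by rewrite -ab !inE eqxx.
apply: (leq_bigmax_cond M (F := fun M : {set {set T}} => #|M|)).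
have sME : M \subset edges e.
  apply/subsetP=> _ /imsetP[a aA ->]; apply/imsetP; exists (a, p a) => //=.
  by rewrite inE /= rtA.
have covM x : x \in cover M -> exists2 a, a \in A & x \in [set a; p a].
  by case/bigcupP=> _ /imsetP[a aA ->] xa; exists a.
apply/and3P; split=> //.
  apply/trivIsetP=> _ _ /imsetP[a aA ->] /imsetP[b bA ->] ab.
  apply/pred0P=> x /=; apply/negP=> /andP[xa xb].
  by case/negP: ab; rewrite (meet _ _ _ aA bA xa xb).
apply/eqP/setP=> E; rewrite inE; apply/andP/idP; last first.
  by move=> EM; split; [exact: (subsetP sME) | exact: bigcup_sup].
case=> /imsetP[[x y]]; rewrite inE /= => exy -> /subsetP sub.
have [a aA xa] := covM x (sub _ (set21 _ _)).
have [b bA yb] := covM y (sub _ (set22 _ _)).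
apply/imsetP; exists a => //; move: exy; move: xa yb; rewrite !in_blk.
move=> /orP[]/eqP-> /orP[]/eqP->.
- by rewrite (negPf (indA _ _ aA bA)).
- by rewrite rtA // => /eqP->.
- by rewrite e_sym rtA // => /eqP->; rewrite setUC.
- by rewrite (negPf (indp _ _ aA bA)).
Qed.

Definition dominating_rooted_matching W : Prop :=
  exists A p, [/\ A \subset W, {in A, forall a, p a \in W},
    rooted_matching A p & covering W A].

(** By minimality of the dominating subset A of the side X, each a in A has a
private neighbour outside X. *)
Lemma bipartite_dominating : bipartite e -> dominating_rooted_matching setT.
Proof.
case=> X bipX.
pose dom A := [forall y, (y \notin X) ==> [exists x, e x y]
                 ==> [exists a in A, e a y]].
have domX : dom X.
  apply/forallP=> y; apply/implyP=> yX; apply/implyP=> /existsP[x exy].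
  apply/existsP; exists x; rewrite exy andbT.
  by move: (bipX _ _ exy) yX; case: (x \in X); case: (y \in X).
have [A /minsetP[/forallP domA minA] sAX] := minset_exists domX.
have priv a : a \in A ->
    exists y, [&& y \notin X & [forall b in A, e b y == (b == a)]].
  move=> aA; have ndom : ~~ dom (A :\ a).
    apply/negP=> d; have := minA _ d (subsetDl _ _) => /setP/(_ a).
    by rewrite !inE eqxx aA.
  case/forallPn: ndom => y; rewrite !negb_imply => /and3P[yX yN].
  rewrite andbT => /pred0P ynot.
  exists y; rewrite yX /=.
  have only b : b \in A -> e b y -> b = a.
    move=> bA eby; apply/eqP; apply: contraFT (ynot b) => ba.
    by rewrite /= !inE ba bA.
  have := domA y; rewrite yX yN /= => /existsP[c /andP[cA ecy]].
  apply/forall_inP=> b bA; apply/eqP; apply/idP/eqP => [|->].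
    exact: only.
  by rewrite -(only c cA ecy).
pose p a := odflt a [pick y | (y \notin X) && [forall b in A, e b y == (b == a)]].
have pP a : a \in A -> p a \notin X /\ {in A, forall b, e b (p a) = (b == a)}.
  move=> aA; rewrite /p; case: pickP => [y /andP[yX /forall_inP h]|h] /=.
    by split=> // b bA; apply/eqP/h.
  by have [y] := priv a aA; rewrite h.
exists A, p; split=> //.
  split=> a b aA bA.
  - apply/negP=> /bipX; by rewrite !(subsetP sAX).
  - by have [_ ->] := pP b bA.
  - apply/negP=> /bipX; have [/negPf-> _] := pP a aA.
    by have [/negPf-> _] := pP b bA.
move=> x y _ _ exy.
have key z z' : z \notin X -> e z' z -> exists2 a, a \in A & e a z.
  move=> zX ez; have := domA z; rewrite zX /=.
  have -> /= : [exists x0, e x0 z] by apply/existsP; exists z'.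
  by case/existsP=> a /andP[]; exists a.
have [xX|xX] := boolP (x \in X).
  have yX : y \notin X by move: (bipX _ _ exy); rewrite xX; case: (y \in X).
  by have [a aA eay] := key _ _ yX exy; exists a; rewrite // eay orbT.
by rewrite e_sym in exy; have [a aA eax] := key _ _ xX exy; exists a; rewrite // eax.
Qed.

(** A is a maximal independent set of the base graph, and the partner of a
vertex is the end of its whisker.  The complement of the neighbourhood of A
consists of A and of whisker ends whose base vertex is not in A. *)
Lemma whisker_dominating :
  whisker_graph e -> dominating_rooted_matching setT.
Proof.
case=> U [h [f [h_sym h_irr [g fK gK] eh]]].
pose ind (B : {set U}) := [forall x in B, forall y in B, ~~ h x y].
have ind0 : ind set0 by apply/forall_inP=> x; rewrite inE.
have [B /maxsetP[indB maxB] _] := maxset_exists ind0.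
have indB' x y : x \in B -> y \in B -> ~~ h x y.
  by move=> xB yB; move/forall_inP: indB => /(_ x xB)/forall_inP/(_ y yB).
have domB x : x \notin B -> exists2 b, b \in B & h b x.
  move=> xB; apply/exists_inP; apply: contraNT xB => nex.
  have nb b : b \in B -> ~~ h b x.
    move=> bB; apply: contra nex => hbx; by apply/existsP; exists b; rewrite bB.
  have indxB : ind (x |: B).
    apply/forall_inP=> a /setU1P[->|aB]; apply/forall_inP=> b /setU1P[->|bB].
    - by rewrite h_irr.
    - by rewrite h_sym nb.
    - exact: nb.
    - exact: indB'.
  by rewrite -(maxB _ indxB (subsetUr _ _)) setU11.
pose p t := if g t is inl u then f (inr u) else t.
have pf u : p (f (inl u)) = f (inr u) by rewrite /p fK.
exists [set f (inl u) | u in B], p; split=> //.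
  split=> _ _ /imsetP[a aB ->] /imsetP[b bB ->]; rewrite ?pf eh //=.
    exact: indB'.
  apply/eqP/eqP => [->//|/(can_inj fK) []//].
have covl u w : h u w -> exists2 a, a \in [set f (inl u) | u in B] &
    e a (f (inl u)) || e a (f (inl w)).
  have [uB huw|uB _] := boolP (u \in B).
    by exists (f (inl u)); rewrite ?imset_f // orbC eh /= huw.
  have [b bB hb] := domB u uB.
  by exists (f (inl b)); rewrite ?imset_f // eh /= hb.
have covw u : exists2 a, a \in [set f (inl u) | u in B] &
    e a (f (inl u)) || e a (f (inr u)).
  have [uB|uB] := boolP (u \in B).
    by exists (f (inl u)); rewrite ?imset_f // orbC eh /= eqxx.
  have [b bB hb] := domB u uB.
  by exists (f (inl b)); rewrite ?imset_f // eh /= hb.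
move=> x y _ _; rewrite -(gK x) -(gK y) eh.
case: (g x) (g y) => [u|u] [w|w] //=; first exact: covl.
  by move/eqP->; apply: covw.
by move/eqP->; have [a aA ea] := covw w; exists a; rewrite // orbC.
Qed.

Section VertexDecomposable.
Hypothesis free : C4C5_free e.

(** The independence complex of the graph induced on W. *)
Definition independent_sets W : {set {set T}} :=
  [set F in independence_complex e | F \subset W].

Lemma independent_setsP W F :
  reflect ({in F &, forall x y, ~~ e x y} /\ F \subset W)
          (F \in independent_sets W).
Proof.
rewrite !inE; apply: (iffP andP) => -[indF sFW]; split=> //.
  by move=> x y xF yF; move/forall_inP: indF => /(_ x xF)/forall_inP/(_ y yF).
by apply/forall_inP=> x xF; apply/forall_inP=> y yF; apply: indF.
Qed.

Lemma no_induced_C4 a b c d :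
  e a b -> e b c -> e c d -> e d a -> a != c -> b != d ->
  e a c || e b d.
Proof.
move=> ab bc cd da ac bd; apply/negPn/negP; rewrite negb_or => /andP[eac ebd].
have neq x y : e x y -> x != y by apply: contraTneq => ->; rewrite e_irr.
case: free => no4 _; apply: no4; exists (fun i => nth a [:: a; b; c; d] i); split.
  move=> i j /eqP; rewrite nth_uniq //; first by move/eqP/val_inj.
  by rewrite /= !inE !negb_or ac bd (eq_sym a d) !neq.
case=> [[|[|[|[|//]]]] ?] [[|[|[|[|//]]]] ?]; rewrite -!val_eqE /= ?e_irr //;
  by [|apply/negbTE|rewrite e_sym|rewrite e_sym; apply/negbTE].
Qed.

Lemma no_induced_C5 a b c d f :
  e a b -> e b c -> e c d -> e d f -> e f a ->
  a != c -> a != d -> b != d -> b != f -> c != f ->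
  [|| e a c, e a d, e b d, e b f | e c f].
Proof.
move=> ab bc cd df fa ac ad bd bf cf; apply/negPn/negP.
rewrite !negb_or => /and5P[eac ead ebd ebf ecf].
have neq x y : e x y -> x != y by apply: contraTneq => ->; rewrite e_irr.
case: free => _ no5; apply: no5; exists (fun i => nth a [:: a; b; c; d; f] i); split.
  move=> i j /eqP; rewrite nth_uniq //; first by move/eqP/val_inj.
  by rewrite /= !inE !negb_or ac ad bd bf cf (eq_sym a f) !neq.
case=> [[|[|[|[|[|//]]]]] ?] [[|[|[|[|[|//]]]]] ?]; rewrite -!val_eqE /= ?e_irr //;
  by [|apply/negbTE|rewrite e_sym|rewrite e_sym; apply/negbTE].
Qed.

(** Choose S dominating as many neighbours of v as possible.  If x is missed, take
a neighbour w of x outside N[v], add w to S and remove from S the neighbours of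
w.  A neighbour y of v that loses its dominating vertex s in this exchange
would give an induced cycle x w s y (when x and y are adjacent) or v x w s y. *)
Lemma independent_dominating W v :
  (forall x, x \in W -> e v x -> exists w, [/\ w \in W, e x w, w != v & ~~ e v w]) ->
  exists2 S, S \in independent_sets [set w in W | (w != v) && ~~ e v w]
    & forall x, x \in W -> e v x -> exists2 s, s \in S & e x s.
Proof.
move=> outN; pose W' := [set w in W | (w != v) && ~~ e v w].
pose dominated S := [set x in W | e v x && [exists s in S, e x s]].
have ind0 : set0 \in independent_sets W'.
  by apply/independent_setsP; split=> [x|]; rewrite ?sub0set // inE.
case: (arg_maxnP (fun S => #|dominated S|) ind0) => S indS maxS.
exists S => // x xW vx; apply/exists_inP; apply: contraT => xS.
have {xS}xS s : s \in S -> ~~ e x s.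
  by move=> sS; apply: contra xS => xs; apply/existsP; exists s; rewrite sS.
have [w [wW xw wv vw]] := outN x xW vx.
have wW' : w \in W' by rewrite inE wW wv vw.
case/independent_setsP: indS => indS sSW'.
pose S' := w |: [set s in S | ~~ e w s].
have indS' : S' \in independent_sets W'.
  apply/independent_setsP; split; last first.
    rewrite subUset sub1set wW'; apply/subsetP=> s; rewrite inE => /andP[sS _].
    exact: (subsetP sSW').
  move=> a b; rewrite !inE => /orP[/eqP->|/andP[aS wa]] /orP[/eqP->|/andP[bS wb]].
  - by rewrite e_irr.
  - by [].
  - by rewrite e_sym.
  - exact: indS.
have := maxS _ indS'; rewrite /= leqNgt => /negP; case; apply: proper_card.
apply/properP; split; last first.
  exists x; last by rewrite inE xW vx; apply/existsP=> -[s /andP[/xS/negP]].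
  by rewrite inE xW vx; apply/existsP; exists w; rewrite !inE eqxx.
apply/subsetP=> y; rewrite !inE => /and3P[yW vy /existsP[s /andP[sS ys]]].
rewrite yW vy /=; apply/existsP.
have [ws|ws] := boolP (e w s); last by exists s; rewrite !inE sS ws orbT.
exists w; rewrite !inE eqxx /=; apply/negPn/negP=> yw.
have := subsetP sSW' s sS; rewrite inE => /and3P[_ sv vs].
have xs := xS s sS.
have nx_s : x != s by apply: contraNneq vs => <-.
have nw_y : w != y by apply: contraNneq vw => ->.
have [xy|xy] := boolP (e x y).
  have := no_induced_C4 xw ws _ _ nx_s nw_y; rewrite (negPf xs) (e_sym w) (negPf yw).
  by rewrite e_sym ys e_sym xy => /(_ isT isT).
have nx_y : x != y by apply: contraNneq xs => ->.
have := no_induced_C5 vx xw ws _ _ _ _ nx_s nx_y nw_y.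
rewrite (negPf vw) (negPf vs) (negPf xs) (negPf xy) (e_sym w y) (negPf yw).
rewrite e_sym ys (e_sym y v) vy (eq_sym v w) wv (eq_sym v s) sv.
by move=> /(_ isT isT isT isT).
Qed.

(** Otherwise some independent set outside N[v] dominates all neighbours of v in W;
a facet of the deletion containing it avoids N[v], so v can be added to it,
against the shedding condition. *)
Lemma shedding_vertex_neighbor W v :
  v \in W ->
  (forall F, facet (deletion (independent_sets W) v) F ->
             facet (independent_sets W) F) ->
  exists x, [/\ x \in W, e v x & forall w, w \in W -> e x w -> (w == v) || e v w].
Proof.
move=> vW shed.
have [/existsP[x /and3P[xW vx /forall_inP sub]]|nex] := boolP [exists x,
  [&& x \in W, e v x & [forall w in W, e x w ==> (w == v) || e v w]]].
  by exists x; split=> // w wW; apply: implyP; apply: sub.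
have [] := @independent_dominating W v.
  move=> x xW vx; move/existsPn: nex => /(_ x).
  rewrite xW vx /= => /forall_inPn[w wW].
  by rewrite negb_imply negb_or => /and3P[xw wv vw]; exists w.
move=> S /independent_setsP[indS sSW'] domS.
have SW s : s \in S -> [/\ s \in W, s != v & ~~ e v s].
  by move/(subsetP sSW'); rewrite inE => /and3P.
have delS : S \in deletion (independent_sets W) v.
  rewrite inE; apply/andP; split.
    apply/independent_setsP; split=> //; apply/subsetP=> s /SW[] //.
  by apply/negP=> /SW[_]; rewrite eqxx.
have [F facF sSF] := maxset_exists delS.
have /maxsetP[/independent_setsP[indF sFW] maxF] := shed F facF.
have : F \in deletion (independent_sets W) v := maxsetp facF.
rewrite inE => /andP[_ vF].
have vNF x : x \in F -> ~~ e v x.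
  move=> xF; apply/negP=> vx; have [s sS] := domS x (subsetP sFW x xF) vx.
  by rewrite (negPf (indF _ _ xF (subsetP sSF s sS))).
have indvF : v |: F \in independent_sets W.
  apply/independent_setsP; split; last by rewrite subUset sub1set vW.
  move=> a b /setU1P[->|aF] /setU1P[->|bF].
  - by rewrite e_irr.
  - exact: vNF.
  - by rewrite e_sym vNF.
  - exact: indF.
by case/negP: vF; rewrite -(maxF _ indvF (subsetUr _ _)) setU11.
Qed.

(** Only the links of the shedding vertices matter: the link of v is the
independence complex of the complement of N[v], and v is added to the set found
there with a partner x such that N[x] is contained in N[v]. *)
Lemma vertex_decomposable_dominating_in D W :
  vertex_decomposable D -> D = independent_sets W -> dominating_rooted_matching W.
Proof.
move=> vdD; elim: vdD W => {D} [|B|D v vD _ _ _ IH shed] W.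
- move/setP/(_ set0); rewrite in_set0 => /esym/negP[].
  by apply/independent_setsP; split=> [x|]; rewrite ?sub0set // inE.
- move=> DW; exists set0, id; split; rewrite ?sub0set //.
  + by move=> a; rewrite inE.
  + by split=> a b; rewrite inE.
  have WB x : x \in W -> x \in B.
    move=> xW; have : [set x] \in independent_sets W.
      apply/independent_setsP; split; last by rewrite sub1set.
      by move=> a b /set1P-> /set1P->; rewrite e_irr.
    by rewrite -DW inE sub1set.
  move=> x y xW yW exy; have : [set x; y] \in powerset B.
    by rewrite inE subUset !sub1set !WB.
  rewrite DW => /independent_setsP[/(_ x y)]; rewrite set21 set22 exy.
  by move=> /(_ isT isT).
- move=> DW; rewrite {D}DW in vD IH shed.
  have vW : v \in W by case/independent_setsP: vD => _; rewrite sub1set.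
  have [x [xW vx sub]] := shedding_vertex_neighbor vW shed.
  pose W' := [set w in W | (w != v) && ~~ e v w].
  have [|A [p [sAW' pW' [indA rtA indp] covA]]] := IH W'.
    apply/setP=> F; rewrite inE; apply/andP/independent_setsP.
      case=> vF /independent_setsP[indF sFW]; split.
        by move=> a b aF bF; apply: indF; rewrite inE ?aF ?bF orbT.
      apply/subsetP=> a aF; rewrite inE (subsetP sFW) ?setU1r //=.
      rewrite indF ?setU11 ?setU1r // andbT.
      by apply: contraNneq vF => <-.
    case=> indF sFW'.
    have FW' a : a \in F -> [/\ a \in W, a != v & ~~ e v a].
      by move/(subsetP sFW'); rewrite inE => /and3P.
    split; first by apply/negP=> /FW'[_]; rewrite eqxx.
    apply/independent_setsP; split.
      move=> a b /setU1P[->|aF] /setU1P[->|bF].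
      - by rewrite e_irr.
      - by case: (FW' _ bF).
      - by rewrite e_sym; case: (FW' _ aF).
      - exact: indF.
    by apply/subsetP=> a /setU1P[->|/FW'[]] //.
  have inW' a : a \in W' -> [/\ a \in W, a != v, ~~ e v a & ~~ e x a].
    rewrite inE => /and3P[aW av va]; split=> //.
    by apply/negP=> /(sub a aW); rewrite (negPf av) (negPf va).
  have AW' a : a \in A -> a \in W' by move/(subsetP sAW').
  have vA : v \notin A by apply/negP=> /AW'/inW'[_]; rewrite eqxx.
  pose p' a := if a == v then x else p a.
  have pv : p' v = x by rewrite /p' eqxx.
  have pA a : a \in A -> p' a = p a.
    by move=> aA; rewrite /p'; case: eqP aA vA => // -> ->.
  exists (v |: A), p'; split.
  + rewrite subUset sub1set vW; apply/subsetP=> a /AW'/inW'[] //.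
  + by move=> a /setU1P[->|aA]; rewrite ?pv // pA //; case: (inW' _ (pW' _ aA)).
  + split=> a b /setU1P[->|aA] /setU1P[->|bA]; rewrite ?pv ?pA ?e_irr ?eqxx //.
    * by case: (inW' _ (AW' _ bA)).
    * by rewrite e_sym; case: (inW' _ (AW' _ aA)).
    * exact: indA.
    * case: (inW' _ (pW' _ bA)) => _ _ /negPf-> _; apply/esym/negbTE.
      by apply: contraNneq vA => ->.
    * rewrite e_sym; case: (inW' _ (AW' _ aA)) => _ av _ /negPf->.
      by rewrite (negPf av).
    * exact: rtA.
    * by case: (inW' _ (pW' _ bA)).
    * by rewrite e_sym; case: (inW' _ (pW' _ aA)).
    * exact: indp.
  + move=> y z yW zW eyz.
    have [vy|vy] := boolP (e v y); first by exists v; rewrite ?setU11 ?vy.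
    have [vz|vz] := boolP (e v z); first by exists v; rewrite ?setU11 ?vz ?orbT.
    have [yv|yv] := eqVneq y v; first by rewrite -yv eyz in vz.
    have [zv|zv] := eqVneq z v; first by rewrite -zv e_sym eyz in vy.
    have [||a aA ea] := covA y z _ _ eyz; rewrite ?inE ?yW ?zW ?yv ?zv ?vy ?vz //.
    by exists a => //; rewrite setU1r.
Qed.

Lemma vertex_decomposable_dominating :
  vertex_decomposable_graph e -> dominating_rooted_matching setT.
Proof.
move=> vdG; apply: vertex_decomposable_dominating_in vdG _.
by apply/setP=> F; rewrite !inE subsetT andbT.
Qed.
End VertexDecomposable.

End DominatingMatchings.

Import GRing.Theory.
Local Open Scope ring_scope.

(** * Polynomials supported on a set of monomials *)

Section Supports.
Variables (K : fieldType) (n : nat).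
Local Notation R := {mpoly K[n]}.
Implicit Types (P Q S : pred 'X_{1..n}) (p q : R).

(** For an upward closed P these are the elements of a monomial ideal; other
choices of P express homogeneity. *)
Definition supported P p : Prop := forall m, m \in msupp p -> P m.

Definition upward P : Prop := forall m m', P m -> P (m + m')%MM.

Lemma supported0 P : supported P 0.
Proof. by move=> m; rewrite msupp0. Qed.

Lemma supportedD P p q : supported P p -> supported P q -> supported P (p + q).
Proof.
by move=> Pp Pq m /msuppD_le; rewrite mem_cat => /orP[/Pp|/Pq].
Qed.

Lemma supportedN P p : supported P p -> supported P (- p).
Proof. by move=> Pp m; rewrite (perm_mem (msuppN p)) => /Pp. Qed.

Lemma supportedB P p q : supported P p -> supported P q -> supported P (p - q).
Proof. by move=> Pp Pq; apply: supportedD (supportedN Pq). Qed.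

Lemma supported_sum P (I : Type) (r : seq I) (C : pred I) (f : I -> R) :
  (forall i, C i -> supported P (f i)) -> supported P (\sum_(i <- r | C i) f i).
Proof.
by move=> Pf; elim/big_ind: _ => //; [apply: supported0 | apply: supportedD].
Qed.

Lemma supported_term P c m : P m -> supported P (c *: 'X_[m]).
Proof. by move=> Pm k /msuppZ_le; rewrite msuppX inE => /eqP->. Qed.

Lemma supportedM P Q S p q :
  (forall m m', P m -> Q m' -> S (m + m')%MM) ->
  supported P p -> supported Q q -> supported S (p * q).
Proof.
by move=> PQS Pp Qq m /msuppM_le/allpairsP[[a b] /= [/Pp ? /Qq ? ->]]; apply: PQS.
Qed.

Lemma supportedMl P p q : upward P -> supported P q -> supported P (p * q).
Proof.
move=> upP; apply: (@supportedM predT) => // m m' _ Pm'.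
by rewrite addmC; apply: upP.
Qed.

Lemma supportedMr P p q : upward P -> supported P p -> supported P (p * q).
Proof. by move=> upP; rewrite mulrC; apply: supportedMl. Qed.

Lemma mcoeff_supported P p m : supported P p -> ~~ P m -> p@_m = 0.
Proof.
by move=> Pp; apply: contraNeq; rewrite -mcoeff_msupp => /Pp.
Qed.

Lemma mcoeff_XMl (mu : 'X_{1..n}) p : ('X_[mu] * p)@_mu = p@_0.
Proof. by have := mcoeffMX p mu 0%MM; rewrite addm0 mulrC. Qed.

Definition mx_supported P a b (A : 'M[R]_(a, b)) : Prop :=
  forall i j, supported P (A i j).

Lemma mx_supportedD P a b (A B : 'M[R]_(a, b)) :
  mx_supported P A -> mx_supported P B -> mx_supported P (A + B).
Proof. by move=> PA PB i j; rewrite mxE; apply: supportedD. Qed.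

Lemma mx_supportedB P a b (A B : 'M[R]_(a, b)) :
  mx_supported P A -> mx_supported P B -> mx_supported P (A - B).
Proof. by move=> PA PB i j; rewrite !mxE; apply: supportedB. Qed.

Lemma mx_supportedMl P a b c (A : 'M[R]_(a, b)) (B : 'M[R]_(b, c)) :
  upward P -> mx_supported P B -> mx_supported P (A *m B).
Proof.
by move=> upP PB i j; rewrite mxE; apply: supported_sum => k _; apply: supportedMl.
Qed.

Lemma mx_supportedMr P a b c (A : 'M[R]_(a, b)) (B : 'M[R]_(b, c)) :
  upward P -> mx_supported P A -> mx_supported P (A *m B).
Proof.
by move=> upP PA i j; rewrite mxE; apply: supported_sum => k _; apply: supportedMr.
Qed.

(** The quotient collects the terms of p divisible by mu, each divided by mu. *)
Lemma divide_monomial mu P S p (d a : nat) :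
  (forall m, P m -> (mu <= m)%MM \/ S m) ->
  supported P p -> supported (fun m => mdeg m + a == d)%N p ->
  exists2 q, supported (fun m => mdeg m + (a + mdeg mu) == d)%N q
           & supported S (p - 'X_[mu] * q).
Proof.
move=> PS Pp dp.
exists (\sum_(m <- msupp p | (mu <= m)%MM) p@_m *: 'X_[m - mu]).
  rewrite big_seq_cond; apply: supported_sum => m /andP[mp le_mu].
  apply: supported_term; rewrite addnCA -mdegD submK // addnC; exact: dp.
rewrite {1}[p]mpolyE (bigID (fun m => mu <= m)%MM) /= mulr_sumr.
rewrite (eq_bigr (fun m => 'X_[mu] * (p@_m *: 'X_[m - mu]))) => [|m le_mu].
  rewrite addrAC subrr add0r big_seq_cond; apply: supported_sum => m.
  case/andP=> mp nle; apply: supported_term.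
  by case: (PS m (Pp m mp)) => // le; rewrite le in nle.
by rewrite -scalerAr -mpolyXD addmC submK.
Qed.

End Supports.

(** * Null-homotopies on a free resolution *)

Section Resolution.
Variables (K : fieldType) (n : nat).
Local Notation R := {mpoly K[n]}.
Variables (I : R -> Prop) (F : free_sequence K n).
Hypothesis idI : is_ideal I.
Hypothesis resF : minimal_graded_free_resolution I F.

Let aug_homog k : aug F k 0 \is (shift k).-homog.
Proof. by case: resF => -[]. Qed.

Let diff_homog i k l m :
  m \in msupp (diff F i k l) -> (mdeg m + shift l = shift k)%N.
Proof. by case: resF => -[_ h] _ _ _ _; apply: h. Qed.

Let aug_onto p : exists u : 'rV_(rk F 0), I (p - (u *m aug F) 0 0).
Proof. by case: resF. Qed.

Let exact0 (u : 'rV_(rk F 0)) :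
  I ((u *m aug F) 0 0) <-> exists w, u = w *m diff F 0.
Proof. by case: resF. Qed.

Let exactS i (u : 'rV_(rk F i.+1)) :
  u *m diff F i = 0 <-> exists w, u = w *m diff F i.+1.
Proof. by case: resF => _ _ _ h _; apply: h. Qed.

Lemma factor_rows a b c (A : 'M[R]_(a, c)) (D : 'M[R]_(b, c)) :
  (forall k, exists w, row k A = w *m D) -> exists B, A = B *m D.
Proof.
move=> rows; have [w wP] := fin_all_exists rows; exists (\matrix_k w k).
by apply/row_matrixP=> k; rewrite row_mul rowK.
Qed.

Lemma diff_diff i : diff F i.+1 *m diff F i = 0.
Proof.
apply/row_matrixP=> k; rewrite row_mul row0; apply/exactS.
by exists (delta_mx 0 k); rewrite -rowE.
Qed.

Lemma diff_aug k : I ((diff F 0 *m aug F) k 0).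
Proof.
have -> : (diff F 0 *m aug F) k 0 = (row k (diff F 0) *m aug F) 0 0.
  by rewrite -row_mul [RHS]mxE.
by apply/exact0; exists (delta_mx 0 k); rewrite -rowE.
Qed.

Lemma homotopy0 x : I x -> exists A, A *m diff F 0 = x%:M.
Proof.
move=> Ix; have [|A ->] := @factor_rows _ _ _ (x%:M) (diff F 0); last by exists A.
move=> k; apply/exact0; case: idI => _ _ IM.
by rewrite rowE mul_mx_scalar -scalemxAl mxE mulrC; apply: IM.
Qed.

(** Multiplication by x is null-homotopic on the resolution.  Two consecutive
levels A, B of a homotopy suffice to continue it, so the whole homotopy is never
formed. *)
Lemma homotopyS i x : I x -> exists A B,
  B *m diff F i.+1 + diff F i *m A = x%:M.
Proof.
move=> Ix.
have lift j (A : 'M_(rk F j, rk F j.+1)) :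
    (x%:M - diff F j *m A) *m diff F j = 0 -> exists B,
    B *m diff F j.+1 + diff F j *m A = x%:M.
  move=> h; have [|B eB] := @factor_rows _ _ _ (x%:M - diff F j *m A) (diff F j.+1).
    by move=> k; apply/exactS; rewrite -row_mul h row0.
  by exists B; rewrite -eB subrK.
elim: i => [|i [A [B AB]]].
  have [A eA] := homotopy0 Ix; exists A; apply: lift.
  by rewrite mulmxBl -mulmxA eA mul_scalar_mx mul_mx_scalar subrr.
exists B; apply: lift; rewrite mulmxBl -mulmxA.
have -> : B *m diff F i.+1 = x%:M - diff F i *m A by rewrite -AB addrK.
by rewrite mulmxBr mulmxA diff_diff mul0mx subr0 mul_scalar_mx mul_mx_scalar subrr.
Qed.

(** Up to terms supported on P, the multiples of u by elements of I are
boundaries. *)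
Definition lifts_multiples (P : pred 'X_{1..n}) i (u : 'rV[R]_(rk F i)) : Prop :=
  forall x, I x -> exists w, mx_supported P (w *m diff F i - x *: u).

Lemma lifts_multiples0 P u : @lifts_multiples P 0 u.
Proof.
move=> x /homotopy0[A eA]; exists (u *m A).
rewrite -mulmxA eA mul_mx_scalar subrr => i j; rewrite mxE; exact: supported0.
Qed.

(** If w is the image of u under a null-homotopy of the multiplication by x, then
the boundary of w differs from x *: u by the image of the boundary of u under the
homotopy, which is supported on P as the boundary of u is. *)
Lemma lifts_multiplesS P i (u : 'rV[R]_(rk F i.+1)) :
  upward P -> mx_supported P (u *m diff F i) -> lifts_multiples P u.
Proof.
move=> upP Pu x Ix; have [A [B AB]] := homotopyS i Ix.
exists (u *m B); rewrite -mulmxA.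
have -> : B *m diff F i.+1 = x%:M - diff F i *m A by rewrite -AB addrK.
rewrite mulmxBr mul_mx_scalar addrAC subrr add0r mulmxA -mulNmx.
apply: mx_supportedMr => // k j; rewrite mxE; exact: supportedN.
Qed.

(** * Pairing the connecting homomorphisms of coprime monomials *)

Section CoprimeMonomials.
Variables (s : nat) (mu : nat -> 'X_{1..n}) (Z : pred 'I_n).
Hypothesis muI : forall k, (k < s)%N -> I 'X_[mu k].
Hypothesis mu_neq0 : forall k, (k < s)%N -> mu k != 0%MM.
Hypothesis mu_coprime : forall j k, (j < s)%N -> (k < s)%N -> j != k ->
  forall t, mu j t = 0%N \/ mu k t = 0%N.
Hypothesis muZ : forall k t, (k < s)%N -> Z t -> mu k t = 0%N.

(** The monomials of the ideal generated by the variables in Z and by mu k for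
i <= k < s. *)
Definition remaining i (m : 'X_{1..n}) : bool :=
  [exists t, Z t && (0 < m t)%N] ||
  [exists k : 'I_s, (i <= k)%N && (mu k <= m)%MM].

(** The monomials of the ideal generated by mu k for k < i. *)
Definition consumed i (m : 'X_{1..n}) : bool :=
  [exists k : 'I_s, (k < i)%N && (mu k <= m)%MM].

Hypothesis supI : forall p, I p -> supported (remaining 0) p.

Lemma remaining_upward i : upward (remaining i).
Proof.
move=> m m' /orP[/existsP[t /andP[Zt mt]]|/existsP[k /andP[ik le]]]; apply/orP.
  by left; apply/existsP; exists t; rewrite Zt mnmDE addn_gt0 mt.
right; apply/existsP; exists k; rewrite ik /=.
by apply: lepm_trans le _; apply/mnm_lepP=> t; rewrite mnmDE leq_addr.
Qed.

Lemma consumed_upward i : upward (consumed i).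
Proof.
move=> m m' /existsP[k /andP[ik le]]; apply/existsP; exists k; rewrite ik /=.
by apply: lepm_trans le _; apply/mnm_lepP=> t; rewrite mnmDE leq_addr.
Qed.

Lemma lepm_coprime j k m : (j < s)%N -> (k < s)%N -> j != k ->
  (mu j <= mu k + m)%MM -> (mu j <= m)%MM.
Proof.
move=> js ks jk /mnm_lepP le; apply/mnm_lepP=> t.
by move: (le t); rewrite mnmDE; case: (mu_coprime js ks jk t) => ->.
Qed.

Lemma lepm0 (m : 'X_{1..n}) : (m <= 0)%MM -> m = 0%MM.
Proof.
by move/mnm_lepP=> le; apply/mnmP=> t; apply/eqP; have := le t; rewrite mnm0E leqn0.
Qed.

Lemma remaining0 i : ~~ remaining i 0%MM.
Proof.
rewrite negb_or; apply/andP; split; apply/existsPn=> k.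
  by rewrite mnm0E ltnn andbF.
by apply/andP=> -[_ /lepm0/eqP]; rewrite (negPf (mu_neq0 _)).
Qed.

Lemma remaining_step i m :
  (i < s)%N -> remaining i m -> (mu i <= m)%MM \/ remaining i.+1 m.
Proof.
move=> si /orP[Zm|/existsP[k /andP[ik le]]]; first by right; rewrite /remaining Zm.
move: ik; rewrite leq_eqVlt => /orP[/eqP->|ik]; [by left | right].
by apply/orP; right; apply/existsP; exists k; rewrite ik.
Qed.

(** mu i is a nonzerodivisor modulo the ideal of [remaining i.+1]. *)
Lemma remaining_cancel i m :
  (i < s)%N -> remaining i.+1 (mu i + m)%MM -> remaining i.+1 m.
Proof.
move=> si /orP[/existsP[t /andP[Zt]]|/existsP[k /andP[ik le]]].
  rewrite mnmDE muZ // => mt; apply/orP; left; by apply/existsP; exists t; rewrite Zt.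
apply/orP; right; apply/existsP; exists k; rewrite ik /=.
by apply: lepm_coprime le; rewrite // gtn_eqF.
Qed.

Lemma remaining_mu i : (i < s)%N -> ~~ remaining i.+1 (mu i).
Proof.
move=> si; apply: contra (remaining0 i.+1) => h.
by apply: (remaining_cancel si); rewrite addm0.
Qed.

Lemma consumed_mu i : (i < s)%N -> ~~ consumed i (mu i).
Proof.
move=> si; apply/existsPn=> k; apply/andP=> -[ki].
rewrite -[mu i]addm0 => /lepm_coprime le.
have /lepm0/eqP : (mu k <= 0)%MM by apply: le; rewrite // ltn_eqF.
by rewrite (negPf (mu_neq0 _)).
Qed.

Lemma consumedS i m : consumed i m -> consumed i.+1 m.
Proof.
by case/existsP=> k /andP[ki le]; apply/existsP; exists k; rewrite le ltnW.
Qed.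

Lemma consumedS_mu i m : (i < s)%N -> consumed i.+1 (mu i + m)%MM.
Proof.
move=> si; apply/existsP; exists (Ordinal si); rewrite /= ltnSn /=.
by apply/mnm_lepP=> t; rewrite mnmDE leq_addr.
Qed.

Lemma supported_cancel i (p : R) : (i < s)%N ->
  supported (remaining i.+1) ('X_[mu i] * p) -> supported (remaining i.+1) p.
Proof.
move=> si sp m mp; apply: (remaining_cancel si); apply: sp.
by rewrite mcoeff_msupp mulrC mcoeffMX -mcoeff_msupp.
Qed.

(** Minus the degree of the i-th cochain of [paired_cochain]. *)
Definition weight i := (\sum_(k < i) mdeg (mu k))%N.

(** The induction step compares the two sides of the identity
mu i * (w psi' - u psi) = (w d - mu i u) psi - w rho, where rho is the remainder
of d psi by mu i: neither term on the right contains the monomial mu i, so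
w psi' and u psi have the same constant term. *)
Lemma paired_cochain i : (i <= s)%N ->
  exists (psi : 'cV[R]_(rk F i)) (u : 'rV[R]_(rk F i)),
  [/\ forall k, supported (fun m => mdeg m + weight i == shift k)%N (psi k 0),
      mx_supported (remaining i) (diff F i *m psi),
      ((u *m psi) 0 0)@_0 = 1
    & lifts_multiples (consumed i) u].
Proof.
elim: i => [_|i IH si].
  have [u Iu] := aug_onto 1; exists (aug F), u; split.
  - move=> k m mk; rewrite /weight big_ord0 addn0.
    by rewrite (dhomog_mf (aug_homog k) mk).
  - by move=> k j; rewrite (ord1 j); apply: supI; apply: diff_aug.
  - have /eqP := mcoeff_supported (supI Iu) (remaining0 0).
    by rewrite mcoeffB mcoeff1 eqxx subr_eq0 => /eqP.
  - exact: lifts_multiples0.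
(* psi' is the quotient of d psi by mu i, and w is a lift of mu i *: u. *)
have [psi [u [dpsi cpsi unit_u lift_u]]] := IH (ltnW si).
have upR := @remaining_upward i.+1; have upC := @consumed_upward i.
have : forall k, exists q, supported (fun m => mdeg m + weight i.+1 == shift k)%N q
    /\ supported (remaining i.+1) ((diff F i *m psi) k 0 - 'X_[mu i] * q).
  move=> k; have [|||q dq rq] := @divide_monomial K n (mu i) (remaining i)
      (remaining i.+1) ((diff F i *m psi) k 0) (shift k) (weight i).
  - by move=> m; apply: remaining_step.
  - exact: cpsi.
  - rewrite mxE; apply: supported_sum => l _.
    apply: (@supportedM _ _ (fun m => mdeg m + shift l == shift k)%N
                            (fun m => mdeg m + weight i == shift l)%N).
    + by move=> m m' /eqP<- /eqP<-; rewrite mdegD addnA.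
    + by move=> m /diff_homog/eqP.
    + exact: dpsi.
  - by exists q; split=> //; rewrite /weight big_ord_recr.
case/fin_all_exists=> q qP; pose psi' := \col_k q k.
have [w wP] := lift_u _ (muI si).
pose rho := diff F i *m psi - 'X_[mu i] *: psi'.
have rhoP : mx_supported (remaining i.+1) rho.
  by move=> k j; rewrite (ord1 j) !mxE; have [_] := qP k; rewrite mxE.
exists psi', w; split.
- by move=> k; rewrite mxE; have [] := qP k.
- move=> k j; apply: (supported_cancel si).
  have -> : 'X_[mu i] * (diff F i.+1 *m psi') k j = - (diff F i.+1 *m rho) k j.
    rewrite /rho mulmxBr mulmxA diff_diff mul0mx sub0r -scalemxAr.
    by rewrite !mxE opprK.
  by apply: supportedN; apply: mx_supportedMl.
- pose a := w *m psi'; pose b := u *m psi.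
  have eqab : 'X_[mu i] *: a - 'X_[mu i] *: b =
      (w *m diff F i - 'X_[mu i] *: u) *m psi - w *m rho.
    rewrite /rho mulmxBl mulmxBr mulmxA -scalemxAl -scalemxAr.
    by rewrite opprB [RHS]addrC addrA subrK.
  have : supported (predU (consumed i) (remaining i.+1))
      (('X_[mu i] *: a - 'X_[mu i] *: b) 0 0).
    rewrite eqab; apply: mx_supportedB => k j m mm; apply/orP.
      by left; apply: mx_supportedMr upC wP k j m mm.
    by right; apply: mx_supportedMl upR rhoP k j m mm.
  have -> : ('X_[mu i] *: a - 'X_[mu i] *: b) 0 0 =
      'X_[mu i] * a 0 0 - 'X_[mu i] * b 0 0.
    by move: (a) (b) => a' b'; rewrite !mxE.
  move/(@mcoeff_supported _ _ _ _ (mu i)).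
  rewrite mcoeffB !mcoeff_XMl unit_u => h; apply/eqP; rewrite -subr_eq0; apply/eqP/h.
  by rewrite /= negb_or consumed_mu ?remaining_mu.
- apply: lifts_multiplesS; first exact: consumed_upward.
  have -> : w *m diff F i = (w *m diff F i - 'X_[mu i] *: u) + 'X_[mu i] *: u.
    by rewrite subrK.
  apply: mx_supportedD => k j m mm; first exact: consumedS (wP _ _ _ mm).
  move: mm; rewrite mxE mulrC (perm_mem (msuppMX _ _)) => /mapP[m' _ ->].
  exact: consumedS_mu.
Qed.

Lemma shift_coprime_monomials : exists k : 'I_(rk F s), shift k = weight s.
Proof.
have [psi [u [dpsi _ unit_u _]]] := paired_cochain (leqnn s).
have [k uk] : exists k, (u 0 k * psi k 0)@_0 != 0.
  apply/existsP; apply: contraT => /existsPn h.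
  have /eqP : ((u *m psi) 0 0)@_0 = 0.
    by rewrite mxE raddf_sum big1 // => k _; apply/eqP/negPn/h.
  by rewrite unit_u oner_eq0.
exists k; suff: 0%MM \in msupp (psi k 0).
  by move/dpsi; rewrite mdeg0 add0n => /eqP.
rewrite mcoeff_msupp; apply: contraNneq uk => pk0.
by rewrite (rmorphM (mcoeff 0%MM)) /= pk0 mulr0.
Qed.

End CoprimeMonomials.
End Resolution.

(** * Edge ideals *)
Section EdgeIdeals.
Variables (K : fieldType) (T : finType) (e : rel T).
Hypothesis e_irr : irreflexive e.
Local Notation R := {mpoly K[#|T|]}.
Implicit Types (A S : {set T}) (L : R -> Prop).

Lemma edge_ideal_is_ideal : is_ideal (edge_ideal K e).
Proof.
split.
- exists (fun _ _ => 0); rewrite big1 // => x _; rewrite big1 // => y _.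
  by rewrite mul0r.
- move=> _ _ [c ->] [d ->]; exists (fun x y => c x y + d x y).
  rewrite -big_split; apply: eq_bigr => x _; rewrite -big_split.
  by apply: eq_bigr => y _; rewrite mulrDl.
- move=> r _ [c ->]; exists (fun x y => r * c x y).
  rewrite mulr_sumr; apply: eq_bigr => x _; rewrite mulr_sumr.
  by apply: eq_bigr => y _; rewrite mulrA.
Qed.

Lemma edge_ideal_edge x y :
  e x y -> edge_ideal K e ('X_(enum_rank x) * 'X_(enum_rank y)).
Proof.
move=> exy; exists (fun a b => ((a == x) && (b == y))%:R).
rewrite (bigD1 x) //= (bigD1 y) //= !eqxx mul1r !big1 ?addr0 //.
  by move=> a /negPf->; rewrite big1 // => b _; rewrite mul0r.
by move=> b /andP[_ /negPf->]; rewrite mul0r.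
Qed.

Lemma edge_ideal_min L : is_ideal L ->
  (forall x y, e x y -> L ('X_(enum_rank x) * 'X_(enum_rank y))) ->
  forall p, edge_ideal K e p -> L p.
Proof.
move=> [L0 LD LM] Le _ [c ->]; elim/big_ind: _ => // x _.
by elim/big_ind: _ => // y exy; apply/LM/Le.
Qed.

Definition set_monomial S : 'X_{1..#|T|} :=
  [multinom (enum_val i \in S : nat) | i < #|T|].

Lemma set_monomialE S i : set_monomial S i = (enum_val i \in S).
Proof. by rewrite mnmE. Qed.

Lemma mdeg_set_monomial S : mdeg (set_monomial S) = #|S|.
Proof.
rewrite mdegE (reindex enum_rank) /=; last exact/onW_bij/enum_rank_bij.
rewrite -[RHS]sum1_card [RHS]big_mkcond; apply: eq_bigr => x _.
by rewrite set_monomialE enum_rankK; case: (x \in S).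
Qed.

Lemma set_monomial_edge x y : x != y ->
  'X_[set_monomial [set x; y]] = 'X_(enum_rank x) * 'X_(enum_rank y) :> R.
Proof.
move=> xy; rewrite -mpolyXD; congr mpolyX; apply/mnmP=> i.
rewrite set_monomialE mnmDE !mnm1E !inE -(enum_valK i) enum_rankK.
rewrite !(inj_eq enum_rank_inj) !(eq_sym _ (enum_val i)).
by have [->|] := eqVneq (enum_val i) x; rewrite ?(negPf xy).
Qed.

(** A substitution that is the identity modulo L on the variables is the identity
modulo L. *)
Lemma comp_mpoly_congr L (lq : #|T|.-tuple R) : is_ideal L ->
  (forall i, L ('X_i - tnth lq i)) -> forall p, L (p - (p \mPo lq)).
Proof.
case=> L0 LD LM Li.
have mul a b c d : L (a - b) -> L (c - d) -> L (a * c - b * d).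
  move=> ab cd; have -> : a * c - b * d = c * (a - b) + b * (c - d).
    by rewrite !mulrBr (mulrC c a) (mulrC c b) addrA subrK.
  by apply: LD; apply: LM.
elim/mpolyind => [|c m p _ _ Lp]; first by rewrite comp_mpoly0 subr0.
rewrite comp_mpolyD comp_mpolyZ opprD addrACA -scalerBr.
apply: LD => //; rewrite -mul_mpolyC; apply: LM.
rewrite comp_mpolyX mpolyXE_id; elim/big_ind2: _ => [|a b c' d|i _].
- by rewrite subrr.
- exact: mul.
- elim: (m i) => [|k IH]; first by rewrite !expr0 subrr.
  by rewrite !exprS; apply: mul.
Qed.

(** The colon ideal is the kernel of the substitution that kills the variables of
the neighbourhood N of A, and this kernel is prime.  The substitution fixes the
product f of the variables of A, as A is independent, and kills the edge ideal,
as N is a vertex cover; conversely each variable of N times f is a multiple of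
an edge. *)
Lemma v_attained_dominating A :
  {in A &, forall a b, ~~ e a b} -> covering e setT A ->
  v_attained (edge_ideal K e) #|A|.
Proof.
move=> indA covA; pose N := [set x | [exists a in A, e a x]].
have NA x : x \in A -> x \notin N.
  move=> xA; rewrite inE; apply/negP=> /existsP[a /andP[aA]].
  by rewrite (negPf (indA _ _ aA xA)).
pose lq := [tuple if enum_val i \in N then 0 else 'X_i | i < #|T|] : #|T|.-tuple R.
have lqE i : tnth lq i = if enum_val i \in N then 0 else 'X_i by rewrite tnth_mktuple.
pose f : R := 'X_[set_monomial A].
have [I0 ID IM] := edge_ideal_is_ideal.
have colP : is_ideal (colon (edge_ideal K e) f).
  rewrite /colon; split=> [|p q|r p]; first by rewrite mul0r.
    by rewrite mulrDl; apply: ID.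
  by rewrite -mulrA; apply: IM.
have lqf : f \mPo lq = f.
  rewrite /f comp_mpolyX mpolyXE_id; apply: eq_bigr => i _; rewrite lqE.
  by rewrite set_monomialE; case: (boolP (_ \in A)) => [/NA/negPf->|].
have kerP g : colon (edge_ideal K e) f g <-> g \mPo lq = 0.
  split=> [|g0]; last first.
    rewrite -[g]subr0 -g0; apply: comp_mpoly_congr => // i; rewrite lqE.
    case: ifPn => [|_]; last by rewrite subrr; case: colP.
    rewrite subr0 inE => /existsP[a /andP[aA ea]]; rewrite /colon.
    have fE : f = 'X_[(set_monomial A - U_(enum_rank a))] * 'X_(enum_rank a).
      rewrite -mpolyXD submK //; apply/mnm_lepP=> j.
      rewrite mnm1E set_monomialE; case: eqP => // <-.
      by rewrite enum_rankK aA.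
    rewrite fE mulrCA (mulrC 'X_i); apply: IM.
    by rewrite -(enum_valK i); apply: edge_ideal_edge.
  have kills : forall p, edge_ideal K e p -> p \mPo lq = 0.
    apply: (@edge_ideal_min (fun p => p \mPo lq = 0)).
      split=> [|p q p0 q0|r p p0]; first exact: comp_mpoly0.
        by rewrite comp_mpolyD p0 q0 addr0.
      by rewrite rmorphM /= p0 mulr0.
    move=> x y exy; rewrite rmorphM /= !comp_mpolyXU -!tnth_nth !lqE !enum_rankK.
    have [a aA /orP[ea|ea]] := covA x y (in_setT _) (in_setT _) exy.
      have -> : x \in N by rewrite inE; apply/existsP; exists a; rewrite aA.
      by rewrite mul0r.
    have -> : y \in N by rewrite inE; apply/existsP; exists a; rewrite aA.
    by rewrite mulr0.
  by move/kills; rewrite rmorphM /= lqf => /eqP; rewrite mulf_eq0 -(msupp_eq0 f) msuppX orbF => /eqP.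
exists f; first by rewrite dhomogX /= mdeg_set_monomial.
exists (colon (edge_ideal K e) f) => //; split; last by exists f.
split=> // [/kerP/eqP|p q /kerP].
  by rewrite comp_mpoly1 oner_eq0.
rewrite rmorphM /= => /eqP; rewrite mulf_eq0 => /orP[]/eqP/kerP ?; by [left|right].
Qed.

(** The resolution has a basis element of homological degree #|M| and internal
degree 2 * #|M|, provided by [shift_coprime_monomials]. *)
Lemma induced_matching_le_regularity M r :
  induced_matching e M -> is_regularity (edge_ideal K e) r -> (#|M| <= r)%N.
Proof.
case/and3P=> sME /trivIsetP trivM /eqP covM [F [resF _ reg]].
pose blk k := nth set0 (enum M) k.
have blkM k : (k < #|M|)%N -> blk k \in M.
  by rewrite cardE => kM; rewrite -mem_enum mem_nth.
have edgeP B : B \in edges e ->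
    exists x y, [/\ x != y, e x y & B = [set x; y]].
  case/imsetP=> -[x y]; rewrite inE /= => exy ->; exists x, y; split=> //.
  by apply: contraTneq exy => ->; rewrite e_irr.
have sub_cover k x : (k < #|M|)%N -> x \in blk k -> x \in cover M.
  by move=> kM; apply/subsetP/bigcup_sup/blkM.
pose mu k := set_monomial (blk k).
pose Z (i : 'I_#|T|) := enum_val i \notin cover M.
have degmu k : (k < #|M|)%N -> mdeg (mu k) = 2.
  move=> /blkM/(subsetP sME)/edgeP[x [y [xy _ eB]]].
  by rewrite mdeg_set_monomial eB cards2 xy.
have [||||p Ip|k sk] := @shift_coprime_monomials K _ _ F edge_ideal_is_ideal resF #|M| mu Z.
- move=> k /blkM/(subsetP sME)/edgeP[x [y [xy exy eB]]].
  by rewrite /mu eB set_monomial_edge //; apply: edge_ideal_edge.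
- by move=> k kM; rewrite -mdeg_eq0 degmu.
- move=> j k jM kM jk t; rewrite !set_monomialE.
  have : [disjoint blk j & blk k].
    apply: trivM; rewrite ?blkM // nth_uniq ?enum_uniq -?cardE //.
  move/pred0P/(_ (enum_val t)) => /= /negbT; rewrite negb_and.
  by case/orP=> /negPf->; [left|right].
- move=> k t kM nt; rewrite set_monomialE.
  by case: (boolP (enum_val t \in blk k)) => // /(sub_cover _ _ kM); rewrite (negPf nt).
- apply: edge_ideal_min Ip; first split.
  + exact: supported0.
  + by move=> p1 p2; apply: supportedD.
  + by move=> p1 p2; apply: supportedMl; apply: remaining_upward.
  (* An edge inside the cover belongs to M since M is induced; any other edge has an
     end outside the cover. *)
  move=> x y exy m; have xy : x != y by apply: contraTneq exy => ->; rewrite e_irr.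
  rewrite -set_monomial_edge // msuppX inE => /eqP->.
  have [cov|] := boolP ([set x; y] \subset cover M).
    have xyM : [set x; y] \in M.
      rewrite -covM inE cov andbT; apply/imsetP; exists (x, y) => //.
      by rewrite inE.
    have kM : (index [set x; y] (enum M) < #|M|)%N by rewrite cardE index_mem mem_enum.
    apply/orP; right; apply/existsP; exists (Ordinal kM) => /=.
    by rewrite /mu /blk nth_index ?mem_enum // lepm_refl.
  case/subsetPn=> z zxy zM; apply/orP; left; apply/existsP; exists (enum_rank z).
  by rewrite /Z set_monomialE enum_rankK zM zxy.
have wE : weight mu #|M| = (2 * #|M|)%N.
  rewrite /weight (eq_bigr (fun=> 2)) => [|k' _]; last exact: degmu.
  by rewrite sum_nat_const card_ord mulnC.
have /reg : betti F #|M| (2 * #|M|) != 0%N.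
  by rewrite -lt0n; apply/card_gt0P; exists k; rewrite inE sk wE.
by rewrite mul2n -addnn leq_add2l.
Qed.

End EdgeIdeals.

(** * The theorem *)

Lemma is_v_number_le (K : fieldType) n (I : {mpoly K[n]} -> Prop) d :
  v_attained I d -> exists2 v, is_v_number I v & (v <= d)%N.
Proof.
elim/ltn_ind: d => d IH vd.
have [[d' [vd' ltd]]|nex] := classic (exists d', v_attained I d' /\ (d' < d)%N).
  by have [v vP le] := IH d' ltd vd'; exists v => //; apply: leq_trans le (ltnW ltd).
exists d => //; split=> // d' vd'; rewrite leqNgt; apply/negP=> ltd.
by apply: nex; exists d'.
Qed.

Theorem mainTheorem5 (K : fieldType) (T : finType) (e : rel T)
    (e_sym : symmetric e) (e_irr : irreflexive e)
    (hG : bipartite e \/ (C4C5_free e /\ vertex_decomposable_graph e)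
          \/ whisker_graph e) :
  (exists2 v : nat, is_v_number (edge_ideal K e) v
     & (v <= induced_matching_number e)%N)
  /\ (forall r : nat, is_regularity (edge_ideal K e) r ->
        (induced_matching_number e <= r)%N).
Proof.
split; last first.
  move=> r reg; apply/bigmax_leqP=> M indM.
  exact: (induced_matching_le_regularity e_irr indM reg).
have [A [p [_ _ matchA covA]]] : dominating_rooted_matching e setT.
  case: hG => [bip|[[free vd]|wh]].
  - exact: bipartite_dominating.
  - exact: vertex_decomposable_dominating.
  - exact: whisker_dominating.
have [indA _ _] := matchA.
have [v vP le] := is_v_number_le (v_attained_dominating K indA covA).
by exists v => //; apply: leq_trans le (rooted_matching_le e_sym matchA).
Qed.
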